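(* Let $G=(X,b,m,c)$ be a weighted graph with $c=0$ on $X$, and let $p\in(1,\infty)$. Assume that $G$ is $p$-parabolic and let $K\subseteq X$ be a finite non-empty set. Then there exists a function $\kappa\colon X\to[0,\infty)$ such that (a) $\kappa\in D^p$; (b) $\kappa$ is $p$-superharmonic on $X\setminus K$ (i.e. $\kappa\in F^p(X\setminus K)$ and $\Delta_p\kappa\ge 0$ on $X\setminus K$) and $\kappa=0$ on $K$; (c) $\kappa(x)\to\infty$ as $x\to\infty$, i.e. for every $M>0$ there is a finite set $F\subseteq X$ with $\kappa>M$ on $X\setminus F$.
   Context: A weighted graph $G=(X,b,m,c)$ consists of a countably infinite set $X$, a symmetric function $b\colon X\times X\to[0,\infty)$ with $b(x,x)=0$ and $\sum_{y\in X}b(x,y)<\infty$ for all $x$, a function $m\colon X\to(0,\infty)$ and a potential $c\colon X\to[0,\infty)$. Write $x\sim y$ if $b(x,y)>0$; $X$ is assumed connected (any two vertices are joined by a finite path $x=x_0\sim x_1\sim\dots\sim x_n=y$). For $p\in[1,\infty)$ and $f\colon X\to\mathbb{R}$, $\mathcal{E}_p(f)=\frac12\sum_{x,y\in X}b(x,y)|f(x)-f(y)|^p+\sum_{x\in X}c(x)|f(x)|^p$, and $D^p=\{f:\mathcal{E}_p(f)<\infty\}$. $C_c(X)$ denotes finitely supported functions. For finite $K\subseteq X$, $\mathrm{cap}_p(K)=\inf\{\mathcal{E}_p(\varphi):\varphi\in C_c(X),\ \varphi\ge1 \text{ on } K\}$; the graph is $p$-parabolic if $\mathrm{cap}_p(K)=0$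 for every finite $K$, and $p$-hyperbolic otherwise. For $a\in\mathbb{R}$ put $a^{\langle p-1\rangle}=|a|^{p-2}a$ (and $0^{\langle p-1\rangle}=0$). For $V\subseteq X$, $F^p(V)=\{f\colon X\to\mathbb{R}:\sum_{y}b(x,y)|f(x)-f(y)|^{p-1}<\infty\ \forall x\in V\}$, and for $f\in F^p(V)$, $x\in V$: $\Delta_pf(x)=\frac1{m(x)}\sum_{y\in X}b(x,y)(f(x)-f(y))^{\langle p-1\rangle}$. *)

(* Defs.v *)
From HB Require Import structures.
From mathcomp Require Import all_boot all_order all_algebra.
From mathcomp Require Import all_classical all_reals all_analysis.
Set Implicit Arguments. Unset Strict Implicit. Unset Printing Implicit Defensive.
Import Order.TTheory GRing.Theory Num.Theory.
Local Open Scope classical_set_scope.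
Local Open Scope ring_scope.

Section Graphs.
Variables (R : realType) (X : choiceType).

Definition countably_infinite : Prop := ([set: X] #= [set: nat])%card.

Definition weighted_graph (b : X -> X -> R) (m : X -> R) (c : X -> R) : Prop :=
  (forall x y, 0 <= b x y) /\ (forall x y, b x y = b y x) /\ (forall x, b x x = 0) /\
      (forall x, (\esum_(y in [set: X]) (b x y)%:E < +oo)%E) /\
      (forall x, 0 < m x) /\ (forall x, 0 <= c x) /\
      (forall x y, exists s : seq X,
          path (fun u v => 0 < b u v) x s /\ last x s = y).

Definition energy (b : X -> X -> R) (c : X -> R) (p : R) (f : X -> R) : \bar R :=
  ((2^-1)%:E * \esum_(xy in [set: X * X]) (b xy.1 xy.2 * `|f xy.1 - f xy.2| `^ p)%:E
   + \esum_(x in [set: X]) (c x * `|f x| `^ p)%:E)%E.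

Definition in_Dp b c p (f : X -> R) : Prop := (energy b c p f < +oo)%E.

Definition finitely_supported (f : X -> R) : Prop := finite_set [set x | f x != 0].

Definition capacity b c p (K : set X) : \bar R :=
  ereal_inf [set energy b c p phi | phi in
     [set phi : X -> R | finitely_supported phi /\ forall x, K x -> 1 <= phi x]].

Definition p_parabolic b c p : Prop :=
  forall K : set X, finite_set K -> capacity b c p K = 0%E.

Definition sgnpow (p a : R) : R := if a == 0 then 0 else `|a| `^ (p - 2) * a.

Definition in_Fp b p (V : set X) (f : X -> R) : Prop :=
  forall x, V x -> (\esum_(y in [set: X]) (b x y * `|f x - f y| `^ (p - 1))%:E < +oo)%E.

(* Delta_p f(x) = 1/m(x) sum_y b(x,y) (f x - f y)^<p-1>; the (absolutely
   convergent, for f in F^p) sum over X is the sum of positive parts minus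
   the sum of negative parts. *)
Definition p_laplacian b m p (f : X -> R) (x : X) : R :=
  let g := fun y => (b x y * sgnpow p (f x - f y))%:E in
  (m x)^-1 * fine ((\esum_(y in [set: X]) g^\+ y) - (\esum_(y in [set: X]) g^\- y))%E.

Definition p_superharmonic_on b m p (V : set X) (f : X -> R) : Prop :=
  in_Fp b p V f /\ forall x, V x -> 0 <= p_laplacian b m p f x.

End Graphs.

(* Main.v *)
(* Cutoffs of summably small energy add up to a function [h] of finite energy
   that vanishes on [K] and tends to infinity. The minimiser [kappa] of the
   energy among the functions above [h] that vanish on [K] (an obstacle problem)
   exists by compactness and lower semicontinuity, and it is superharmonic off
   [K] because raising its value at a vertex [x] outside [K] keeps it admissible,
   so the one-sided derivative of the energy in the direction [1_x] is
   nonnegative. *)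
Require Import Defs.
From HB Require Import structures.
From mathcomp Require Import all_boot all_order all_algebra.
From mathcomp Require Import all_classical all_reals all_analysis.
From mathcomp Require Import ring lra.
Set Implicit Arguments. Unset Strict Implicit. Unset Printing Implicit Defensive.
Import Order.TTheory GRing.Theory Num.Theory.
Import numFieldNormedType.Exports.
Local Open Scope classical_set_scope.
Local Open Scope ring_scope.

(** * Continuity and convexity of real powers *)

Lemma normr_powR_cvg (R : realType) (r a : R) : a != 0 ->
  `|x| `^ r @[x --> a] --> `|a| `^ r.
Proof.
move=> a0.
have na : 0 < `|a| by rewrite normr_gt0.
rewrite {2}/powR gt_eqF //.
apply: (@cvg_trans _ (expR (r * ln `|x|) @[x --> a])).
  apply: near_eq_cvg => /=.
  have : \forall x \near a, x != 0.
    by apply: open_nbhs_nbhs; split => //; exact: open_neq.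
  apply: filterS => x x0 /=.
  by rewrite /powR normr_eq0 (negbTE x0).
have nc : `|x| @[x --> a] --> `|a| by apply: cvg_norm; exact: cvg_id.
have lc : ln `|x| @[x --> a] --> ln `|a|.
  exact: (cvg_comp _ _ nc (continuous_ln na)).
have rc : r * ln `|x| @[x --> a] --> r * ln `|a| by exact: cvgMl_tmp.
exact: (cvg_comp _ _ rc (@continuous_expR R _)).
Qed.

Lemma normr_powR_cvg0 (R : realType) (r : R) : 0 < r ->
  `|x| `^ r @[x --> (0 : R)] --> (0 : R).
Proof.
move=> r0; apply/cvgr0Pnorm_lt => e e0.
have e1 : 0 < e `^ r^-1 by rewrite powR_gt0.
near=> x; rewrite ger0_norm ?powR_ge0//.
have -> : e = (e `^ r^-1) `^ r by rewrite -powRrM mulVf ?gt_eqF// powRr1// ltW.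
have xe : `|x| < e `^ r^-1 by near: x; exact: (@nbhs0_lt R R^o).
by apply: gt0_ltr_powR => //; rewrite nnegrE ltW.
Unshelve. all: by end_near. Qed.

Lemma normr_powR_continuous (R : realType) (r : R) : 0 < r ->
  continuous (fun x : R => `|x| `^ r).
Proof.
move=> r0 a; have [->|a0] := eqVneq a 0; last exact: normr_powR_cvg.
by rewrite /continuous_at normr0 powR0 ?gt_eqF//; exact: normr_powR_cvg0.
Qed.

Lemma norm_sgnpow (R : realType) (p a : R) : 1 < p ->
  `|sgnpow p a| = `|a| `^ (p - 1).
Proof.
move=> p1; rewrite /sgnpow; case: eqVneq => [->|a0].
  by rewrite normr0 powR0// subr_eq0 gt_eqF.
rewrite normrM ger0_norm ?powR_ge0// -[X in _ * X]powRr1// -powRD; last first.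
  by rewrite normr_eq0 a0 implybT.
by congr (_ `^ _); ring.
Qed.

(** At [0] the factor with exponent [p - 2] may blow up, so continuity there is read off the norm of
    [sgnpow], whose exponent [p - 1] is positive. *)
Lemma sgnpow_continuous (R : realType) (p : R) : 1 < p ->
  continuous (sgnpow p).
Proof.
move=> p1 a; have [->|a0] := eqVneq a 0.
  rewrite /continuous_at {2}/sgnpow eqxx.
  apply/cvgr0Pnorm_lt => e e0.
  have p10 : 0 < p - 1 by rewrite subr_gt0.
  have /cvgr0Pnorm_lt/(_ _ e0) := normr_powR_cvg0 p10.
  by apply: filterS => x; rewrite norm_sgnpow// ger0_norm// powR_ge0.
apply: (@cvg_trans _ ((`|x| `^ (p - 2) * x) @[x --> a])).
  apply: near_eq_cvg => /=.
  have : \forall x \near a, x != 0.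
    by apply: open_nbhs_nbhs; split => //; exact: open_neq.
  by apply: filterS => x x0; rewrite /sgnpow (negbTE x0).
rewrite /sgnpow (negbTE a0); exact: (cvgM (@normr_powR_cvg R (p - 2) a a0) cvg_id).
Qed.

(** Convexity of the [p]-th power in tangent form at [s]. It follows from Young's inequality for
    [|a|] and [|s|^(p-1)] with exponents [p] and [p / (p - 1)], without differentiation. *)
Lemma powR_tangent (R : realType) (p a s : R) : 1 < p ->
  `|s| `^ p <= `|a| `^ p + p * (sgnpow p s * (s - a)).
Proof.
move=> p1; have p0 : 0 < p by lra.
have [->|s0] := eqVneq s 0.
  by rewrite normr0 powR0 ?gt_eqF// /sgnpow eqxx mul0r mulr0 addr0 powR_ge0.
have ns : 0 < `|s| by rewrite normr_gt0.
have q0 : 0 < p / (p - 1) by rewrite divr_gt0// subr_gt0.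
have := @conjugate_powR R `|a| (`|s| `^ (p - 1)) p (p / (p - 1))
  (normr_ge0 _) (powR_ge0 _ _) p0 q0.
rewrite -powRrM (_ : (p - 1) * (p / (p - 1)) = p); last by field; lra.
have -> : p^-1 + (p / (p - 1))^-1 = 1 by field; lra.
move=> /(_ erefl) Y.
have ss : sgnpow p s * s = `|s| `^ p.
  rewrite /sgnpow (negbTE s0) -mulrA -expr2 -real_normK ?num_real//.
  rewrite -powR_mulrn// -powRD ?normr_eq0 ?s0 ?implybT//.
  by congr (_ `^ _); ring.
rewrite mulrBr ss.
have sa : sgnpow p s * a <= `|a| * `|s| `^ (p - 1).
  by rewrite (le_trans (ler_norm _))// normrM norm_sgnpow// mulrC.
move: Y sa; rewrite (_ : `|s| `^ p / (p / (p - 1)) = `|s| `^ p * (p - 1) / p); last by field; lra.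
set A := _ `^ p; set B := `|s| `^ p; set Z := `|a| * _ => Y sa.
have Y2 : p * Z <= A + B * (p - 1).
  rewrite (_ : A + _ = p * (A / p + B * (p - 1) / p)); last by field; lra.
  by rewrite ler_pM2l.
have : p * (sgnpow p s * a) <= p * Z by rewrite ler_pM2l.
lra.
Qed.

Lemma powR_normD (R : realType) (p a b : R) : 0 < p ->
  `|a + b| `^ p <= 2 `^ p * (`|a| `^ p + `|b| `^ p).
Proof.
move=> p0.
wlog ab : a b / `|a| <= `|b| => [hw|].
  have /orP[ab|ba] := le_total `|a| `|b|; first exact: hw.
  by rewrite addrC [X in _ * X]addrC; exact: hw.
have : `|a + b| `^ p <= (2 * `|b|) `^ p.
  apply: ge0_ler_powR; rewrite ?nnegrE ?mulr_ge0//; first exact: ltW.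
  by apply: (le_trans (ler_normD _ _)); lra.
rewrite powRM//; move=> /le_trans; apply.
by rewrite ler_wpM2l ?powR_ge0// lerDr powR_ge0.
Qed.

(** * Fatou's lemma and the kinetic energy *)

(** The sum is a supremum of finite sums, and each of these passes to the limit. The filter is
    arbitrary because limits are taken along [\oo], along an ultrafilter and along [0^'+]. *)
Lemma esum_fatou (R : realType) (T : choiceType) (I : Type) (F : set_system I)
    {FF : ProperFilter F} (u : I -> T -> R) (v : T -> R) (M : \bar R) :
  (forall x, u i x @[i --> F] --> v x) ->
  (\forall i \near F, (forall x, 0 <= u i x) /\
     (\esum_(x in [set: T]) (u i x)%:E <= M)%E) ->
  (\esum_(x in [set: T]) (v x)%:E <= M)%E.
Proof.
move=> uv uM; apply: ge_ereal_sup => _ [A [finA _] <-].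
rewrite fsbig_finite//=.
have u0 x : \forall i \near F, (0 <= (u i x)%:E)%E.
  by apply: filterS uM => i [u0 _]; rewrite lee_fin.
have cv : (\sum_(x <- finmap.enum_fset (fset_set A)) (u i x)%:E)%E @[i --> F] -->
          (\sum_(x <- finmap.enum_fset (fset_set A)) (v x)%:E)%E.
  apply: cvg_nnesum => // x _.
  by apply: cvg_EFin; [exact: nearW|exact: uv].
apply: (cvge_to_le cv).
apply: filterS uM => i [_ uM]; apply: le_trans uM.
by rewrite -fsbig_finite//; apply: ereal_sup_ubound; exists A.
Qed.

(** Twice the energy when the potential vanishes. *)
Definition kinetic (R : realType) (X : choiceType) (b : X -> X -> R) (p : R)
    (f : X -> R) : \bar R :=
  (\esum_(xy in [set: X * X])
     (b xy.1 xy.2 * `|f xy.1 - f xy.2| `^ p)%:E)%E.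

Lemma ge0_esumZl_le (R : realType) (T : choiceType) (k : R) (a : T -> \bar R) :
  0 <= k -> (forall i, 0 <= a i)%E ->
  (\esum_(i in [set: T]) (k%:E * a i) <= k%:E * \esum_(i in [set: T]) a i)%E.
Proof.
move=> k0 a0; apply: ge_ereal_sup => _ [A [finA _] <-].
rewrite -ge0_mule_fsumr//; apply: lee_wpmul2l; first by rewrite lee_fin.
by apply: ereal_sup_ubound; exists A.
Qed.

Section Kinetic.
Variables (R : realType) (X : choiceType) (b : X -> X -> R) (p : R).
Hypotheses (b0 : forall x y, 0 <= b x y) (p1 : 1 < p).

Lemma kinetic_ge0 f : (0 <= kinetic b p f)%E.
Proof. by apply: esum_ge0 => xy _; rewrite lee_fin mulr_ge0// powR_ge0. Qed.

Lemma energy_kinetic (c : X -> R) f : (forall x, c x = 0) ->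
  energy b c p f = ((2^-1)%:E * kinetic b p f)%E.
Proof.
move=> c0; rewrite /energy -/(kinetic b p f) [X in (_ + X)%E]esum1 ?adde0//.
by move=> x _; rewrite c0 mul0r.
Qed.

Lemma kinetic_fatou (I : Type) (F : set_system I) {FF : ProperFilter F}
    (u : I -> X -> R) (f : X -> R) (M : \bar R) :
  (forall x, u i x @[i --> F] --> f x) ->
  (\forall i \near F, kinetic b p (u i) <= M)%E -> (kinetic b p f <= M)%E.
Proof.
move=> uf uM; apply: (@esum_fatou _ _ I F FF
  (fun i xy => b xy.1 xy.2 * `|u i xy.1 - u i xy.2| `^ p)).
  move=> [x y]/=; apply: cvgMl_tmp.
  have d : u i x - u i y @[i --> F] --> f x - f y by apply: cvgB.
  apply: (cvg_comp _ _ d (@normr_powR_continuous R p _ (f x - f y))).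
  by rewrite (lt_trans ltr01).
by apply: filterS uM => i uM; split => // xy; rewrite mulr_ge0// powR_ge0.
Qed.

Lemma kinetic_contract f g :
  (forall x y, `|g x - g y| <= `|f x - f y|) ->
  (kinetic b p g <= kinetic b p f)%E.
Proof.
move=> gf; apply: le_esum => -[x y] _ /=; rewrite lee_fin ler_wpM2l//.
by apply: ge0_ler_powR; rewrite ?nnegrE// ltW// (lt_trans ltr01).
Qed.

Lemma kineticD (f g : X -> R) :
  (kinetic b p (f \+ g)%R <= (2 `^ p)%:E * (kinetic b p f + kinetic b p g))%E.
Proof.
have e0 h (xy : X * X) :
    (0 <= (b xy.1 xy.2 * `|h xy.1 - h xy.2| `^ p)%:E :> \bar R)%E.
  by rewrite lee_fin mulr_ge0// powR_ge0.
rewrite /kinetic -esumD//; apply: le_trans (ge0_esumZl_le _ _); last 2 first.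
- exact: powR_ge0.
- by move=> xy; exact: adde_ge0.
apply: le_esum => -[x y] _ /=.
rewrite -EFinD -EFinM lee_fin -mulrDr mulrCA ler_wpM2l//.
rewrite (_ : f x + g x - _ = (f x - f y) + (g x - g y)); last by ring.
by apply: powR_normD; rewrite (lt_trans ltr01).
Qed.

(* Peeling off one summand costs a factor [2 `^ p] by [kineticD]; the ratio
   [2 * 2 `^ p] of the geometric bound absorbs it. *)
Lemma kinetic_sum (g : nat -> X -> R) (A : R) N : 0 <= A ->
  (forall i, kinetic b p (g i) <= (A / (2 * 2 `^ p) ^+ i)%:E)%E ->
  (kinetic b p (fun x => \sum_(i < N) g i x)%R <= (2 * 2 `^ p * A)%:E)%E.
Proof.
have C0 : 0 < 2 `^ p :> R by rewrite powR_gt0.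
set D := 2 * 2 `^ p; have D0 : 0 < D by rewrite mulr_gt0.
elim: N g A => [|N IH] g A A0 gA.
  rewrite /kinetic esum1 ?lee_fin ?mulr_ge0 ?(ltW D0)// => xy _.
  rewrite !big_ord0 subrr normr0 powR0 ?mulr0// gt_eqF//.
  by rewrite (lt_trans ltr01).
have := IH (fun i => g i.+1) _ (divr_ge0 A0 (ltW D0)).
have gS i : (kinetic b p (g i.+1) <= (A / D / D ^+ i)%:E)%E.
  by rewrite (le_trans (gA _))// lee_fin exprS invfM mulrA.
move=> /(_ gS) H.
rewrite (_ : (fun x => _) = g 0%N \+ (fun x => \sum_(i < N) g i.+1 x)); last first.
  by apply/funext => x; rewrite big_ord_recl.
apply: (le_trans (kineticD _ _)).
rewrite (_ : D * A = 2 `^ p * (A + D * (A / D))); last first.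
  by rewrite /D; field; rewrite gt_eqF.
rewrite EFinM; apply: lee_wpmul2l; first by rewrite lee_fin ltW.
rewrite EFinD; apply: leeD => //.
by have := gA 0%N; rewrite expr0 divr1.
Qed.

Lemma kinetic_edge f (B : R) x y : (kinetic b p f <= B%:E)%E -> 0 < b x y ->
  `|f x - f y| <= (B / b x y) `^ p^-1.
Proof.
move=> fB bxy.
have p0 : 0 < p by rewrite (lt_trans ltr01).
have : ((b x y * `|f x - f y| `^ p)%:E <= B%:E)%E.
  apply: le_trans fB; apply: esum_ge.
  by exists [set (x, y)]; [split => //; exact: finite_set1|rewrite fsbig_set1].
rewrite lee_fin mulrC -ler_pdivlMr// => h.
rewrite -[leLHS]powRr1// -(mulfV (lt0r_neq0 p0)) powRrM.
apply: ge0_ler_powR; rewrite ?invr_ge0 ?(ltW p0) ?nnegrE ?powR_ge0//.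
by rewrite (le_trans _ h) ?powR_ge0.
Qed.

(** Each edge term bounds the increment of [f] across that edge; adding these bounds along a path
    from [o] gives a [C] independent of [f]. This is the pointwise compactness used for minimising
    sequences. *)
Lemma kinetic_bounded (B : R) (o x : X) :
  (exists s, path (fun u v => 0 < b u v) o s /\ last o s = x) ->
  exists C : R, forall f, (kinetic b p f <= B%:E)%E -> f o = 0 -> `|f x| <= C.
Proof.
move=> [s [ps <-]] {x}; elim/last_ind: s ps => [|s y IH].
  by move=> _; exists 0 => f _ /= ->; rewrite normr0.
rewrite rcons_path last_rcons => /andP[/IH[C hC] ey].
exists (C + (B / b (last o s) y) `^ p^-1) => f fB fo.
have := kinetic_edge fB ey; have := hC f fB fo.
set z := last o s => h1 h2.
have -> : f y = f z - (f z - f y) by ring.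
by rewrite (le_trans (ler_normB _ _))// lerD.
Qed.

End Kinetic.

(** * The exhaustion function and the obstacle problem *)

Lemma ultra_bounded_cvg (R : realType) (I : Type) (U : set_system I)
    (u : I -> R) (C : R) : UltraFilter U -> (forall i, `|u i| <= C) ->
  exists l : R, u i @[i --> U] --> l.
Proof.
move=> UU uC; have PU : ProperFilter U by exact: ultra_proper.
have hU : (u i @[i --> U]) `[- C, C]%classic.
  by apply: nearW => i /=; rewrite in_itv/= -ler_norml.
have [l [_ cl]] := @segment_compact R (- C) C (u @ U) _ hU.
exists l => V lV; have [//|UV] := in_ultra_setVsetC (u @^-1` V) UU.
by have [y [/= nVy Vy]] := cl (~` V) V UV lV.
Qed.

Section Obstacle.
Variables (R : realType) (X : choiceType) (b : X -> X -> R) (p : R).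
Hypotheses (b0 : forall x y, 0 <= b x y) (p1 : 1 < p).

Lemma exhaustion_of_cutoffs (e : X -> nat) (phi : nat -> X -> R) :
  injective e ->
  (forall n, finitely_supported (phi n)) ->
  (forall n x, (e x <= n)%N -> 1 <= phi n x) ->
  (forall n, (kinetic b p (phi n) <= ((2 * 2 `^ p) ^- n)%:E)%E) ->
  exists h : X -> R, [/\ (forall x, 0 <= h x),
    (forall x, (forall n, 1 <= phi n x) -> h x = 0),
    (kinetic b p h < +oo)%E &
    forall M : R, exists F : set X, finite_set F /\ forall x, ~ F x -> M < h x].
Proof.
move=> einj phifin phi1 phiE.
(* The truncation is 1-Lipschitz, so it does not increase the energy of [phi n]; [g n] is [0] where
   [phi n] is at least [1], and [1] off the support of [phi n]. *)
pose g n x := Num.max 0 (1 - phi n x).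
have g0 n x : 0 <= g n x by rewrite le_max lexx.
have gz n x : 1 <= phi n x -> g n x = 0.
  by move=> ?; apply/max_idPl; rewrite subr_le0.
(* The full series at [x] is this finite sum: [g i x = 0] as soon as [e x <= i]. *)
pose h x := \sum_(0 <= i < e x) g i x.
have hN N x : (e x <= N)%N -> \sum_(0 <= i < N) g i x = h x.
  move=> exN; rewrite (big_cat_nat (leq0n _) exN)//= [X in _ + X]big_nat_cond [X in _ + X]big1 ?addr0//.
  by move=> i /andP[/andP[exi _] _]; exact/gz/phi1.
have hge N x : \sum_(0 <= i < N) g i x <= h x.
  have [exN|/ltnW Nex] := leqP (e x) N; first by rewrite hN.
  by rewrite /h (big_cat_nat (leq0n _) Nex)//= lerDl sumr_ge0.
exists h; split.
- by move=> x; rewrite sumr_ge0.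
- by move=> x h1; rewrite /h big1// => i _; exact: gz.
(* This is the bound of [kinetic_sum] with [A = 1]; it is uniform in the number of terms, so Fatou
   carries it to [h]. *)
- apply: (@le_lt_trans _ _ ((2 * 2 `^ p * 1)%:E)); last exact: ltry.
  apply: (@kinetic_fatou _ _ _ _ b0 p1 nat \oo _
    (fun N x => \sum_(i < N) g i x)).
    move=> x; apply: cvg_near_cst.
    near=> N; rewrite -(big_mkord xpredT (g ^~ x)); apply: hN.
    by near: N; exact: nbhs_infty_ge.
  apply: nearW => N; apply: kinetic_sum => // i.
  rewrite mul1r; apply: le_trans (phiE i); apply: kinetic_contract => // x y.
  have pos_lip (s t : R) : `|Num.max 0 s - Num.max 0 t| <= `|s - t|.
    have := ler_norm (s - t); have := ler_norm (t - s); rewrite [`|t - s|]distrC.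
    move: `|s - t| => d; rewrite ler_norml /Num.max.
    by case: (ltP 0 s); case: (ltP 0 t) => *; apply/andP; split; lra.
  by apply: (le_trans (pos_lip _ _)); rewrite distrC le_eqVlt; apply/orP; left; apply/eqP; congr `|_|; ring.
(* Off the supports of the first [N] cutoffs each of the first [N] terms equals [1], so [h] is at
   least [N], which exceeds [M]. *)
- move=> M; pose N := (Num.truncn `|M|).+1.
  exists (\bigcup_(i in `I_N) [set x | phi i x != 0]); split.
    by apply: bigcup_finite => [|i _]; [exact: finite_II|exact: phifin].
  move=> x nFx; apply: lt_le_trans (hge N x).
  rewrite [ltRHS](_ : _ = N%:R); last first.
    rewrite -{2}[N]subn0 -sumr_const_nat; apply: eq_big_nat => i iN.
    have : phi i x = 0.
      by apply/eqP; apply: contrapT => /negP px; apply: nFx; exists i.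
    by rewrite /g => ->; rewrite subr0; apply/max_idPr; exact: ler01.
  by apply: (le_lt_trans (ler_norm M)); exact: truncnS_gt.
Unshelve. all: by end_near. Qed.

(** Direct method: the vertex [o] in [K] anchors all competitors at [0], so bounded energy bounds
    them at every vertex, and both constraints survive pointwise limits. *)
Lemma kinetic_obstacle_min (K : set X) (h : X -> R) (o : X) :
  (forall x, exists s, path (fun u v => 0 < b u v) o s /\ last o s = x) ->
  K o -> (forall x, K x -> h x = 0) -> (kinetic b p h < +oo)%E ->
  exists k : X -> R, [/\ (forall x, h x <= k x), (forall x, K x -> k x = 0),
    (kinetic b p k < +oo)%E &
    forall f, (forall x, h x <= f x) -> (forall x, K x -> f x = 0) ->
      (kinetic b p k <= kinetic b p f)%E].
Proof.
move=> con Ko hK hfin.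
pose A := [set f : X -> R | (forall x, h x <= f x) /\ (forall x, K x -> f x = 0)].
pose i0 := ereal_inf [set kinetic b p f | f in A].
have i0h : (i0 <= kinetic b p h)%E by apply: ereal_inf_lbound; exists h.
have i0ge : (0 <= i0)%E.
  by apply: le_ereal_inf_tmp => _ [f _ <-]; exact: kinetic_ge0.
have i0fin : i0 \is a fin_num.
  by rewrite ge0_fin_numE// (le_lt_trans i0h).
have /choice[f fP] n : exists f, A f /\ (kinetic b p f < i0 + (n.+1%:R^-1)%:E)%E.
  have [|_ [f Af <-] fi] := @lb_ereal_inf_adherent R [set kinetic b p f | f in A] n.+1%:R^-1 _ i0fin.
    by rewrite invr_gt0.
  by exists f.
(* Along an ultrafilter a minimising sequence converges at every vertex at once,
   so no diagonal extraction is needed. *)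
have [U [UU oU]] := @ultraFilterLemma nat \oo _.
have PU : ProperFilter U by exact: ultra_proper.
have fB n : (kinetic b p (f n) <= (fine i0 + 1)%:E)%E.
  apply: (le_trans (ltW (fP n).2)); rewrite EFinD fineK// leeD2lE// lee_fin.
  by rewrite invf_le1// ler1n.
have /choice[k kP] x : exists l : R, f n x @[n --> U] --> l.
  have [C hC] := kinetic_bounded p1 (fine i0 + 1) (con x).
  apply: (@ultra_bounded_cvg _ _ _ _ C) => // n; apply: hC => //.
  by apply: (fP n).1.2.
have kh x : h x <= k x.
  by apply: (cvgr_to_ge (kP x)); apply: nearW => n; exact: (fP n).1.1.
have kK x : K x -> k x = 0.
  move=> Kx; apply: (cvg_unique _ (kP x)) => //.
  by apply: cvg_near_cst; apply: nearW => n; exact: (fP n).1.2.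
have ki : (kinetic b p k <= i0)%E.
  (* A bound valid eventually along [\oo] is valid along the finer filter [U], so Fatou gives
     [i0 + eps] for every [eps]. *)
  apply/lee_addgt0Pr => eps eps0.
  apply: (kinetic_fatou b0 p1 kP); apply: oU.
  near=> n; apply: (le_trans (ltW (fP n).2)); rewrite leeD2lE// lee_fin ltW//.
  by near: n; exact: near_infty_natSinv_lt (PosNum eps0).
exists k; split => //; first exact: (le_lt_trans ki (le_lt_trans i0h hfin)).
move=> u hu uK; apply: (le_trans ki); apply: ereal_inf_lbound.
by exists u.
Unshelve. all: by end_near. Qed.

End Obstacle.

(** * First variation and superharmonicity of the minimiser *)

(** The tangent inequality at [a y + t] and minimality make the weighted sum of [sgnpow p (a y + t)]
    nonnegative for small [t > 0]; then [t] tends to [0]. A summable majorant [w] is added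
    throughout so that only nonnegative terms are summed. *)
Lemma first_variation_ge0 (R : realType) (T : choiceType) (p : R)
    (beta a : T -> R) : 1 < p -> (forall y, 0 <= beta y) ->
  (\esum_(y in [set: T]) (beta y)%:E < +oo)%E ->
  (\esum_(y in [set: T]) (beta y * `|a y| `^ p)%:E < +oo)%E ->
  (forall t : R, 0 < t ->
    (\esum_(y in [set: T]) (beta y * `|a y| `^ p)%:E <=
     \esum_(y in [set: T]) (beta y * `|a y + t| `^ p)%:E)%E) ->
  let g := fun y => (beta y * sgnpow p (a y))%:E in
  (\esum_(y in [set: T]) (beta y * `|a y| `^ (p - 1))%:E < +oo)%E /\
  (0 <= \esum_(y in [set: T]) g^\+ y - \esum_(y in [set: T]) g^\- y)%E.
Proof.
move=> p1 beta0 betafin S0fin Smin g.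
have p0 : 0 < p by rewrite (lt_trans ltr01).
have p10 : 0 < p - 1 by rewrite subr_gt0.
(* Dominates [sgnpow p (a y + t)] in absolute value for all [t] in [[0, 1]]. *)
pose w y := (`|a y| + 1) `^ (p - 1).
pose W : \bar R := (\esum_(y in [set: T]) (beta y * w y)%:E)%E.
pose S0 : \bar R := (\esum_(y in [set: T]) (beta y * `|a y| `^ p)%:E)%E.
have S0f : S0 \is a fin_num.
  by rewrite ge0_fin_numE//; apply: esum_ge0 => y _; rewrite lee_fin mulr_ge0 ?powR_ge0.
have bw0 y : 0 <= beta y * w y by rewrite mulr_ge0 ?powR_ge0.
have W0 : (0 <= W)%E by apply: esum_ge0 => y _; rewrite lee_fin.
(* As the base is at least [1], the exponent [p - 1] may be raised to [p], and [powR_normD] then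
   bounds [w] by a multiple of [|a y|^p + 1]. *)
have Wfin : W \is a fin_num.
  rewrite ge0_fin_numE//.
  pose z y : \bar R := (beta y * `|a y| `^ p)%:E.
  have z0 y : (0 <= z y)%E by rewrite lee_fin mulr_ge0 ?powR_ge0.
  apply: (@le_lt_trans _ _ ((2 `^ p)%:E * (S0 + \esum_(y in [set: T]) (beta y)%:E))%E).
    rewrite /S0 -esumD//; try by move=> y _; rewrite lee_fin ?mulr_ge0 ?powR_ge0.
    apply: le_trans (ge0_esumZl_le _ _); last 2 first.
    - exact: powR_ge0.
    - by move=> y; apply: (adde_ge0 (z0 y)); rewrite lee_fin.
    apply: le_esum => y _; rewrite -EFinD -EFinM lee_fin -[X in _ + X]mulr1.
    rewrite -mulrDr mulrCA ler_wpM2l//.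
    have n1 : 1 <= `|a y| + 1 by rewrite lerDr.
    apply: (@le_trans _ _ ((`|a y| + 1) `^ p)); first by apply: ler_powR => //; lra.
    have := powR_normD `|a y| 1 p0.
    by rewrite normr_id normr1 powR1 ger0_norm// (le_trans ler01).
  apply: lte_mul_pinfty; rewrite ?lee_fin ?powR_ge0//.
  exact: lte_add_pinfty.
have wge t y : 0 <= t <= 1 -> `|sgnpow p (a y + t)| <= w y.
  move=> /andP[t0 t1]; rewrite norm_sgnpow//.
  apply: ge0_ler_powR; rewrite ?nnegrE ?(ltW p10) ?addr_ge0//.
  by apply: (le_trans (ler_normD _ _)); rewrite lerD2l ger0_norm.
have bwu t y : 0 <= t <= 1 -> 0 <= beta y * (w y - sgnpow p (a y + t)).
  move=> t01; rewrite mulr_ge0// subr_ge0.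
  by apply: (le_trans (ler_norm _)); exact: wge.
(* Nonnegativity of the first variation at [t], shifted by [W]. The tangent inequality is scaled by
   [k = p * t], and the finite [S0] cancels by minimality. *)
have var t : 0 < t <= 1 ->
    (\esum_(y in [set: T]) (beta y * (w y - sgnpow p (a y + t)))%:E <= W)%E.
  move=> /andP[t0 t1].
  have t01 : 0 <= t <= 1 by rewrite ltW.
  pose k := p * t; have k0 : 0 < k by rewrite mulr_gt0.
  have k1 r : (k^-1 * (k * r)) = r by rewrite mulrA mulVf ?mul1r ?gt_eqF.
  pose E1 y : \bar R := (k * (beta y * (w y - sgnpow p (a y + t))))%:E.
  pose E2 y : \bar R := (k * (beta y * w y))%:E.
  have E10 y : (0 <= E1 y)%E by rewrite lee_fin mulr_ge0 ?bwu ?(ltW k0).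
  have E20 y : (0 <= E2 y)%E by rewrite lee_fin mulr_ge0 ?(ltW k0).
  have E12 : (\esum_(y in [set: T]) E1 y <= \esum_(y in [set: T]) E2 y)%E.
    rewrite -(leeD2lE _ _ S0f).
    apply: le_trans (leeD (Smin t t0) (lexx _)) _.
    rewrite /S0 -!esumD//; try by move=> y _; rewrite lee_fin mulr_ge0 ?powR_ge0.
    apply: le_esum => y _; rewrite -!EFinD lee_fin /E1 /E2.
    have := powR_tangent (a y) (a y + t) p1.
    rewrite (_ : a y + t - a y = t); last by ring.
    move=> /(ler_wpM2l (beta0 y)); rewrite /k; lra.
  apply: (@le_trans _ _ ((k^-1)%:E * \esum_(y in [set: T]) E1 y)%E).
    apply: le_trans (ge0_esumZl_le _ E10); last by rewrite invr_ge0 ltW.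
    by apply: le_esum => y _; rewrite /E1 -EFinM k1.
  apply: (@le_trans _ _ ((k^-1)%:E * (k%:E * W))%E).
    apply: lee_wpmul2l; first by rewrite lee_fin invr_ge0 ltW.
    apply: (le_trans E12).
    apply: le_trans (@ge0_esumZl_le _ _ k (fun y => (beta y * w y)%:E) (ltW k0) _).
      by apply: le_esum => y _; rewrite -EFinM.
    by move=> y; rewrite lee_fin.
  by rewrite muleA -EFinM mulVf ?gt_eqF// mul1e.
(* Dominated convergence as [t] tends to [0+]: Fatou applied to the nonnegative
   differences [w y - sgnpow p (a y + t)]. *)
have var0 : (\esum_(y in [set: T]) (beta y * (w y - sgnpow p (a y)))%:E <= W)%E.
  apply: (@esum_fatou _ _ R (0^'+) _
    (fun t y => beta y * (w y - sgnpow p (a y + t)))).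
    move=> y; apply: cvgMl_tmp; apply: cvgB; first exact: cvg_cst.
    apply: cvg_at_right_filter.
    have d : a y + t @[t --> (0 : R)] --> a y.
      by rewrite -[X in _ --> X]addr0; apply: cvgD; [exact: cvg_cst|exact: cvg_id].
    exact: (cvg_comp _ _ d (@sgnpow_continuous R p p1 (a y))).
  have : \forall t \near (0 : R)^'+, 0 < t <= 1.
    near=> t; apply/andP; split; near: t; first exact: nbhs_right_gt.
    exact: nbhs_right_le.
  apply: filterS => t /[dup] tt /var; split => //.
  by move=> y; apply: bwu; case/andP: tt => /ltW -> ->.
(* Both sides have nonnegative terms, so the identity can be summed; cancelling the finite [W] then
   compares the negative and positive parts. *)
have gE y : (g^\+ y + (beta y * (w y - sgnpow p (a y)))%:E =
             (beta y * w y)%:E + g^\- y)%E.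
  rewrite funeposE funenegE /g -EFinN -!EFin_max -!EFinD; congr EFin.
  by rewrite /Num.max; case: ltP => ?; case: ltP => ?; lra.
have b0w y : (0 <= (beta y * (w y - sgnpow p (a y)))%:E :> \bar R)%E.
  by rewrite lee_fin -[a y]addr0; apply: bwu; rewrite lexx ler01.
have sumE : (\esum_(y in [set: T]) g^\+ y +
    \esum_(y in [set: T]) (beta y * (w y - sgnpow p (a y)))%:E =
    W + \esum_(y in [set: T]) g^\- y)%E.
  rewrite /W -!esumD//; last by move=> y _; rewrite lee_fin.
  by apply: eq_esum.
have NP : (\esum_(y in [set: T]) g^\- y <= \esum_(y in [set: T]) g^\+ y)%E.
  by rewrite -(leeD2lE _ _ Wfin) -sumE addeC leeD.
have bpw y : beta y * `|a y| `^ (p - 1) <= beta y * w y.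
  rewrite ler_wpM2l//; apply: ge0_ler_powR; rewrite ?nnegrE ?(ltW p10) ?addr_ge0//.
  by rewrite lerDl.
have Wlt : (W < +oo)%E by rewrite ltey_eq Wfin.
split.
  by apply: le_lt_trans Wlt; apply: le_esum => y _; rewrite lee_fin.
(* The negative part is dominated by [beta y * w y], hence has a finite sum, which excludes a
   difference of two infinities. *)
rewrite sube_ge0// ; apply/orP; left.
rewrite ge0_fin_numE; last exact: esum_ge0.
apply: le_lt_trans Wlt; apply: le_esum => y _.
rewrite funenegE /g -EFinN -EFin_max lee_fin ge_max bw0 andbT.
apply: le_trans (bpw y); rewrite -mulrN ler_wpM2l// -norm_sgnpow//.
by rewrite -normrN ler_norm.
Unshelve. all: by end_near. Qed.

Section Vertex.
Variables (R : realType) (X : choiceType) (b : X -> X -> R) (p : R).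
Hypotheses (b0 : forall x y, 0 <= b x y) (bsym : forall x y, b x y = b y x)
  (bdiag : forall x, b x x = 0).

(** By symmetry of [b], the ordered pairs [(x, y)] and [(y, x)] contribute the same star sum [S];
    pairs avoiding [x] do not see the value [f x]. *)
Lemma kinetic_split x : exists rest : (X -> R) -> \bar R,
  [/\ forall f, (0 <= rest f)%E,
      forall f f', (forall y, y != x -> f y = f' y) -> rest f = rest f' &
      forall f, let S := (\esum_(y in [set: X]) (b x y * `|f x - f y| `^ p)%:E)%E in
        kinetic b p f = (S + S + rest f)%E].
Proof.
pose B := [set uv : X * X | uv.1 = x]; pose C := [set uv : X * X | uv.2 = x].
pose k (f : X -> R) (uv : X * X) : \bar R :=
  (b uv.1 uv.2 * `|f uv.1 - f uv.2| `^ p)%:E.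
have k0 f uv : (0 <= k f uv)%E by rewrite lee_fin mulr_ge0 ?powR_ge0.
exists (fun f => \esum_(uv in ~` B `&` ~` C) k f uv)%E; split.
- by move=> f; exact: esum_ge0.
- move=> f f' ff'; apply: eq_esum => -[u v] /= [/= /eqP ux /eqP vx].
  by rewrite /k /= !ff'.
move=> f S.
rewrite -[kinetic b p f]/(\esum_(uv in [set: X * X]) k f uv)%E (esumID B)//.
rewrite [X in (_ + X)%E = _](esumID C)// !setTI addeA; congr (_ + _ + _)%E.
  rewrite (@reindex_esum _ _ _ [set: X] B (fun y => (x, y)))//.
  split => //; first by move=> y z _ _ [].
  by move=> [u v] Buv; exists v => //; rewrite -[x in LHS]Buv.
(* The pair [(x, x)] was already counted in [B]; the column is completed by it at no cost because
   [b x x = 0]. *)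
rewrite (@reindex_esum _ _ _ (~` [set x]) (~` B `&` C) (fun y => (y, x))); last first.
  split => //; first by move=> y z _ _ [].
  by move=> [u v] [ux vx]; exists u => //; rewrite -[x in LHS]vx.
rewrite [RHS](esumID [set x]); last first.
  by move=> y _; rewrite lee_fin mulr_ge0 ?powR_ge0.
rewrite !setTI esum_set1 ?bdiag ?mul0r// add0e.
by apply: eq_esum => y _; rewrite /k /= bsym distrC.
Qed.

(** The two energies share the part away from [x], which is finite because the energy of [f] is, and
    therefore cancels. *)
Lemma vertex_min x f f' : (forall y, y != x -> f y = f' y) ->
  (kinetic b p f < +oo)%E -> (kinetic b p f <= kinetic b p f')%E ->
  (\esum_(y in [set: X]) (b x y * `|f x - f y| `^ p)%:E < +oo)%E /\
  (\esum_(y in [set: X]) (b x y * `|f x - f y| `^ p)%:E <=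
   \esum_(y in [set: X]) (b x y * `|f' x - f' y| `^ p)%:E)%E.
Proof.
move=> ff' ffin fle.
have [rest [r0 rE kE]] := kinetic_split x.
move: ffin fle; rewrite !kE /= (rE _ _ ff'); move: (rest f') (r0 f') => r r_ge0.
have S0 (h : X -> R) : (0 <= \esum_(y in [set: X]) (b x y * `|h x - h y| `^ p)%:E)%E.
  by apply: esum_ge0 => y _; rewrite lee_fin mulr_ge0 ?powR_ge0.
move: (S0 f) (S0 f').
set s := (\esum_(_ in _) _)%E; set s' := (\esum_(_ in _) _)%E.
case: r r_ge0 => [r| |] //; case: s => [s| |] //; case: s' => [s'| |] //=.
- by rewrite !lee_fin => _ _ _ _ le_ss'; rewrite ltry; split => //; lra.
- by move=> *; rewrite ltry leey.
Qed.

End Vertex.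

Lemma obstacle_min_superharmonic (R : realType) (X : choiceType)
    (b : X -> X -> R) (m c : X -> R) (p : R) (K : set X) (h k : X -> R) :
  weighted_graph b m c -> 1 < p ->
  (forall x, h x <= k x) -> (forall x, K x -> k x = 0) ->
  (kinetic b p k < +oo)%E ->
  (forall f, (forall x, h x <= f x) -> (forall x, K x -> f x = 0) ->
      (kinetic b p k <= kinetic b p f)%E) ->
  p_superharmonic_on b m p (~` K) k.
Proof.
move=> [b0 [bsym [bdiag [bfin [m0 [_ _]]]]]] p1 hk kK kfin kmin.
have key x : ~ K x ->
  (\esum_(y in [set: X]) (b x y * `|k x - k y| `^ p)%:E < +oo)%E /\
  (forall t : R, 0 < t ->
    (\esum_(y in [set: X]) (b x y * `|k x - k y| `^ p)%:E <=
     \esum_(y in [set: X]) (b x y * `|k x - k y + t| `^ p)%:E)%E).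
  move=> nKx.
  (* Raising [k] at [x] keeps it above [h] and leaves its values on [K] unchanged, since [x] lies
     outside [K]. *)
  pose f t y := if y == x then k x + t else k y.
  have H t (t0 : 0 < t) :
    (\esum_(y in [set: X]) (b x y * `|k x - k y| `^ p)%:E < +oo)%E /\
    (\esum_(y in [set: X]) (b x y * `|k x - k y| `^ p)%:E <=
     \esum_(y in [set: X]) (b x y * `|f t x - f t y| `^ p)%:E)%E.
    apply: vertex_min => //.
    - by move=> y /negbTE; rewrite /f => ->.
    - apply: kmin => y; rewrite /f; last first.
        by case: eqVneq => [->|_]//; exact: kK.
      by case: eqVneq => [->|_]//; rewrite (le_trans (hk x))// lerDl ltW.
  split; first exact: (H 1 ltr01).1.
  move=> t t0; apply: (le_trans (H t t0).2).
  (* At [y = x] the two differences disagree by [t], but the weight [b x x] is [0]. *)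
  apply: le_esum => y _; rewrite /f eqxx; case: eqVneq => [->|_].
    by rewrite bdiag !mul0r.
  by rewrite addrAC.
split => x nKx; have [f1 f2] := key x nKx; have [v1 v2] :=
  @first_variation_ge0 R X p (b x) (fun y => k x - k y) p1 (b0 x) (bfin x) f1 f2.
  exact: v1.
by apply: mulr_ge0; [rewrite invr_ge0 ltW|exact: fine_ge0].
Qed.

(** * Cutoffs from parabolicity, and assembly of [kappa] *)

Theorem theorem3p27 (R : realType) (X : choiceType)
  (b : X -> X -> R) (m : X -> R) (c : X -> R) (p : R) (K : set X) :
  countably_infinite X ->
  weighted_graph b m c ->
  (forall x, c x = 0) ->
  1 < p ->
  p_parabolic b c p ->
  finite_set K -> K !=set0 ->
  exists kappa : X -> R,
    (forall x, 0 <= kappa x) /\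
    in_Dp b c p kappa /\
    (p_superharmonic_on b m p (~` K) kappa /\ (forall x, K x -> kappa x = 0)) /\
    (forall M : R, 0 < M -> exists F : set X,
        finite_set F /\ forall x, ~ F x -> M < kappa x).
Proof.
move=> Xinf G c0 p1 par finK [ o Ko].
have [b0 [_ [_ [_ [_ [_ con]]]]]] := G.
have /countable_injP[e einj] : countable [set: X] by apply/countable_bijP; exists setT.
have {}einj : injective e by move=> x y; apply: einj; rewrite inE.
have D0 : 0 < 2 * 2 `^ p :> R by rewrite mulr_gt0// powR_gt0.
(* Including [K] in every set makes [h] vanish on [K]; the geometric bound is the one required by
   [kinetic_sum]. *)
have /choice[phi phiP] n : exists f : X -> R,
    [/\ finitely_supported f, forall x, (e x <= n)%N \/ K x -> 1 <= f x &
        (kinetic b p f <= ((2 * 2 `^ p) ^- n)%:E)%E].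
  have finKn : finite_set ([set x | (e x <= n)%N] `|` K).
    rewrite finite_setU; split => //.
    apply: (@sub_finite_set _ _ (e @^-1` `I_n.+1)) => //.
    by apply: finite_preimage; [move=> x y _ _; exact: einj|exact: finite_II].
  (* The capacity is [0], hence below any positive number; the factor [2^-1] accounts for the energy
     being half of [kinetic]. *)
  have /ereal_inf_ltP[_ [f [finf f1] <-] fE] :
      (capacity b c p ([set x | (e x <= n)%N] `|` K) <
       (2^-1 * (2 * 2 `^ p) ^- n)%:E)%E.
    by rewrite (par _ finKn) lte_fin mulr_gt0 ?invr_gt0 ?exprn_gt0.
  exists f; split => //.
  move: fE; rewrite (energy_kinetic _ _ _ c0) EFinM.
  by rewrite lte_pmul2l// ?lte_fin ?invr_gt0// => /ltW.
have [h [h0 hz hfin hM]] := exhaustion_of_cutoffs b0 p1 einj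
  (fun n => let: And3 fs _ _ := phiP n in fs)
  (fun n x en => let: And3 _ f1 _ := phiP n in f1 x (or_introl en))
  (fun n => let: And3 _ _ fE := phiP n in fE).
have hK x : K x -> h x = 0.
  by move=> Kx; apply: hz => n; have [_ f1 _] := phiP n; apply: f1; right.
have [k [hk kK kfin kmin]] := kinetic_obstacle_min b0 p1 (con o) Ko hK hfin.
exists k; split; first by move=> x; exact: le_trans (h0 x) (hk x).
split; first by rewrite /in_Dp (energy_kinetic _ _ _ c0) lte_mul_pinfty// lee_fin.
split; first by split => //; exact: (obstacle_min_superharmonic G p1 hk kK kfin kmin).
move=> M _; have [F [finF FM]] := hM M; exists F; split => // x nFx.
exact: lt_le_trans (FM x nFx) (hk x).
Qed.
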